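(* Let constants $d\ge c>0$ and $\mu>0$ be given. For each maximal solution $\phi$ to the hybrid system $\mathcal H_\varepsilon$ defined in the context, there exists $T^*\ge0$ such that $\phi(t,j)\in\mathcal M$ for any $(t,j)\in\mathrm{dom}\,\phi$ with $t+j\ge T^*$, where $\mathcal M=\mathcal M_1\cup\dots\cup\mathcal M_6$ is the set defined in the context.
   Context: Constants $d\ge c>0$, $\mu>0$. Let $\mathcal P=\{0,1,2,3,4,5\}$, $\mathcal Q=\{0,1\}$. The state is $x=(\tau_i,\tau_k,a_i,a_k,\tau,m^i,m^k,p,q)\in\mathcal X:=\mathbb R\times\mathbb R\times\mathbb R\times\mathbb R\times[0,d]\times\mathbb R^6\times\mathbb R^6\times\mathcal P\times\mathcal Q$, with $m^i=(m^i_1,\dots,m^i_6)$, $m^k=(m^k_1,\dots,m^k_6)$. Set $F(x)=(a_i,a_k,0,0,-1,0,0,0,0)$, and $K_{\tilde o}(m^i)=\tfrac12(m^i_4-m^i_5-m^i_2+m^i_3)$, $K_a(m^i,\tau_k)=\mu\big((m^i_1-m^i_5)-(\tau_k-m^i_4)\big)$. Jump maps, with components listed in the order of $x$: $G_1(x)=(\tau_i,\tau_k,a_i,a_k,d,(\tau_i,m^i_1,\dots,m^i_5),m^k,p+1,1)$, $G_2(x)=(\tau_i,\tau_k,a_i,a_k,c,m^i,(\tau_k,m^i_1,\dots,m^i_5),p+1,0)$, $G_3(x)=(\tau_i,\tau_k,a_i,a_k,d,m^i,(\tau_k,m^k_1,\dots,m^k_5),p+1,1)$, $G_4(x)=(\tau_i,\tau_k,a_i,a_k,c,(\tau_i,m^k_1,\dots,m^k_5),m^k,p+1,0)$,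 $G_5(x)=(\tau_i,\tau_k,a_i,a_k,d,(\tau_i,m^i_1,\dots,m^i_5),m^k,p+1,1)$, $G_6(x)=(\tau_i,\tau_k-K_{\tilde o}(m^i),a_i,a_k+K_a(m^i,\tau_k),c,m^i,(\tau_k,m^i_1,\dots,m^i_5),0,0)$. Error system: $\varepsilon=(\varepsilon_\tau,\varepsilon_a)\in\mathbb R^2$ represents $\varepsilon_\tau=\tau_i-\tau_k$, $\varepsilon_a=a_i-a_k$, and $x_\varepsilon=(\varepsilon,x)\in\mathcal X_\varepsilon:=\mathbb R^2\times\mathcal X$. The data of $\mathcal H_\varepsilon=(C_\varepsilon,F_\varepsilon,D_\varepsilon,G_\varepsilon)$ ($\dot x_\varepsilon=F_\varepsilon(x_\varepsilon)$ for $x_\varepsilon\in C_\varepsilon$; $x_\varepsilon^+=G_\varepsilon(x_\varepsilon)$ for $x_\varepsilon\in D_\varepsilon$) are: $F_\varepsilon(x_\varepsilon)=(A_f\varepsilon,F(x))$ with $A_f=\begin{bmatrix}0&1\\0&0\end{bmatrix}$; $C_\varepsilon=C_{\varepsilon_1}\cup C_{\varepsilon_2}$, $C_{\varepsilon_1}=\{x_\varepsilon\in\mathcal X_\varepsilon:q=0,\tau\in[0,c]\}$, $C_{\varepsilon_2}=\{x_\varepsilon\in\mathcal X_\varepsilon:q=1,\tau\in[0,d]\}$; $D_\varepsilon=\bigcup_{\ell=1}^6D_{\varepsilon_\ell}$, $D_{\varepsilon_\ell}=\{x_\varepsilon\in\mathcal X_\varepsilon:\tau=0,\ p=\ell-1\}$;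 $G_\varepsilon(x_\varepsilon)=G_{\varepsilon_\ell}(x_\varepsilon)$ if $x_\varepsilon\in D_{\varepsilon_\ell}$, where $G_{\varepsilon_\ell}(x_\varepsilon)=(\varepsilon,G_\ell(x))$ for $\ell\in\{1,\dots,5\}$ and $G_{\varepsilon_6}(x_\varepsilon)=\big(\varepsilon+(K_{\tilde o}(m^i),-K_a(m^i,\tau_k)),\,G_6(x)\big)$. The set $\mathcal M$: for $\beta\ge0$ let $\rho_i(x_\varepsilon,\beta)=\tau_i-a_i((1-q)c+qd-\tau)-a_i\beta$, $\rho_k(x_\varepsilon,\beta)=\tau_k-a_k((1-q)c+qd-\tau)-a_k\beta$. Then (all subsets of $\mathcal X_\varepsilon$) $\mathcal M_1=\{p=0,q=0\}$; $\mathcal M_2=\{p=1,q=1,\ m^i_1=\rho_i(x_\varepsilon,0)\}$; $\mathcal M_3=\{p=2,q=0,\ m^k_1=\rho_k(x_\varepsilon,0),\ m^k_2=\rho_i(x_\varepsilon,d)\}$; $\mathcal M_4=\{p=3,q=1,\ m^k_1=\rho_k(x_\varepsilon,0),\ m^k_2=\rho_k(x_\varepsilon,c),\ m^k_3=\rho_i(x_\varepsilon,c+d)\}$; $\mathcal M_5=\{p=4,q=0,\ m^i_1=\rho_i(x_\varepsilon,0),\ m^i_2=\rho_k(x_\varepsilon,d),\ m^i_3=\rho_k(x_\varepsilon,c+d),\ m^i_4=\rho_i(x_\varepsilon,2d+c)\}$; $\mathcal M_6=\{p=5,q=1,\ m^i_1=\rho_i(x_\varepsilon,0),\ m^i_2=\rho_i(x_\varepsilon,c),\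 m^i_3=\rho_k(x_\varepsilon,c+d),\ m^i_4=\rho_k(x_\varepsilon,2c+d),\ m^i_5=\rho_i(x_\varepsilon,2c+2d)\}$. Solutions (in the sense of Goebel–Sanfelice–Teel): a hybrid time domain is a set $E\subset\mathbb R_{\ge0}\times\mathbb N$ such that for each $(T,J)\in E$, $E\cap([0,T]\times\{0,\dots,J\})=\bigcup_{j=0}^J([t_j,t_{j+1}]\times\{j\})$ for some $0=t_0\le t_1\le\dots\le t_{J+1}$. A solution $\phi$ is a function on a hybrid time domain $\mathrm{dom}\,\phi$, locally absolutely continuous in $t$ on each interval $I^j=\{t:(t,j)\in\mathrm{dom}\,\phi\}$, with $\phi(0,0)\in C_\varepsilon\cup D_\varepsilon$; $\phi(t,j)\in C_\varepsilon$ for all $t$ in the interior of $I^j$ and $\frac{d}{dt}\phi(t,j)=F_\varepsilon(\phi(t,j))$ for almost all $t\in I^j$; and $\phi(t,j)\in D_\varepsilon$, $\phi(t,j+1)=G_\varepsilon(\phi(t,j))$ whenever $(t,j),(t,j+1)\in\mathrm{dom}\,\phi$. It is maximal if it cannot be extended by flow or a jump. *)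

(* Defs.v *)
From HB Require Import structures.
From mathcomp Require Import all_boot all_order all_algebra.
From mathcomp Require Import all_classical all_reals all_analysis.

Set Implicit Arguments.
Unset Strict Implicit.
Unset Printing Implicit Defensive.

Import Order.TTheory GRing.Theory Num.Theory.
Import numFieldNormedType.Exports.

Local Open Scope classical_set_scope.
Local Open Scope ring_scope.

(** Hybrid systems and their solutions (Goebel, Sanfelice, Teel) *)

(* The maps are total; their values off the flow set, resp. the jump set, play
   no role in the notion of solution. *)
Record hybrid_system (R : realType) (V : normedModType R) := HybridSystem {
  flow_set : set V ;
  flow_map : V -> V ;
  jump_set : set V ;
  jump_map : V -> V }.

Definition hybrid_time_domain (R : realType) (E : set (R * nat)) : Prop :=
  E `<=` [set s | 0 <= s.1] /\
  forall T J, E (T, J) ->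
    exists t : nat -> R,
      [/\ t 0%N = 0,
          forall j, (j <= J)%N -> t j <= t j.+1 &
          E `&` (`[0, T] `*` `I_J.+1) =
          \bigcup_(j in `I_J.+1) (`[t j, t j.+1] `*` [set j])].

(* The family I need not consist of distinct intervals, but a repeated interval
   is necessarily degenerate and contributes nothing to either sum. *)
Definition absolutely_continuous_on (R : realType) (V : normedModType R)
    (a b : R) (f : R -> V) : Prop :=
  forall e : R, 0 < e -> exists2 delta : R, 0 < delta &
    forall (n : nat) (I : 'I_n -> R * R),
      (forall k, [/\ a <= (I k).1, (I k).1 <= (I k).2 & (I k).2 <= b]) ->
      trivIset setT (fun k => `](I k).1, (I k).2[%classic : set R) ->
      \sum_(k < n) ((I k).2 - (I k).1) < delta ->
      \sum_(k < n) `|f (I k).2 - f (I k).1| < e.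

Definition locally_absolutely_continuous (R : realType) (V : normedModType R)
    (S : set R) (f : R -> V) : Prop :=
  forall a b : R, a <= b -> `[a, b] `<=` S -> absolutely_continuous_on a b f.

(* A function on a hybrid time domain: only the values of arc_val at points of
   arc_dom are meaningful. *)
Record hybrid_arc (R : realType) (V : normedModType R) := HybridArc {
  arc_dom : set (R * nat) ;
  arc_val :> R -> nat -> V }.

Definition flow_interval (R : realType) (V : normedModType R)
    (phi : hybrid_arc V) (j : nat) : set R :=
  [set t | arc_dom phi (t, j)].

(* The two-sided derivative in the flow condition is harmless at the endpoints
   of flow_interval phi j, as these form a null set. *)
Definition solution (R : realType) (V : normedModType R)
    (H : hybrid_system V) (phi : hybrid_arc V) : Prop :=
  [/\ hybrid_time_domain (arc_dom phi),
      arc_dom phi (0, 0%N) /\ (flow_set H `|` jump_set H) (phi 0 0%N),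
      forall j,
        locally_absolutely_continuous (flow_interval phi j) (phi ^~ j),
      forall j,
        (forall t, (flow_interval phi j)° t -> flow_set H (phi t j)) /\
        {ae (@lebesgue_measure R), forall t, flow_interval phi j t ->
          is_derive t 1 (phi ^~ j) (flow_map H (phi t j))} &
      forall t j, arc_dom phi (t, j) -> arc_dom phi (t, j.+1) ->
        jump_set H (phi t j) /\ phi t j.+1 = jump_map H (phi t j)].

Definition maximal_solution (R : realType) (V : normedModType R)
    (H : hybrid_system V) (phi : hybrid_arc V) : Prop :=
  solution H phi /\
  ~ exists psi : hybrid_arc V,
      [/\ solution H psi, arc_dom phi `<` arc_dom psi &
          forall t j, arc_dom phi (t, j) -> psi t j = phi t j].

(** The state space *)

(* Ambient vector space of the states
     (tau_i, tau_k, a_i, a_k, tau, m^i, m^k, p, q);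
   the discrete variables p and q are embedded in R so that the flow acts on
   the whole state, and X below restricts them to their finite ranges. *)
Definition state (R : realType) : Type :=
  (R * R * R * R * R * 'rV[R]_6 * 'rV[R]_6 * R * R)%type.

Definition tau_i (R : realType) (x : state R) : R := x.1.1.1.1.1.1.1.1.
Definition tau_k (R : realType) (x : state R) : R := x.1.1.1.1.1.1.1.2.
Definition a_i (R : realType) (x : state R) : R := x.1.1.1.1.1.1.2.
Definition a_k (R : realType) (x : state R) : R := x.1.1.1.1.1.2.
Definition tau (R : realType) (x : state R) : R := x.1.1.1.1.2.
Definition m_i (R : realType) (x : state R) : 'rV[R]_6 := x.1.1.1.2.
Definition m_k (R : realType) (x : state R) : 'rV[R]_6 := x.1.1.2.
Definition p (R : realType) (x : state R) : R := x.1.2.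
Definition q (R : realType) (x : state R) : R := x.2.

(* entry m l is the coordinate m_l in the numbering l = 1, ..., 6 *)
Definition entry (R : realType) (m : 'rV[R]_6) (l : nat) : R :=
  m 0 (inord l.-1).

(* (t, m_1, ..., m_5) *)
Definition push (R : realType) (t : R) (m : 'rV[R]_6) : 'rV[R]_6 :=
  \row_(l < 6) if l == 0%N :> nat then t else entry m l.

Definition X (R : realType) (d : R) : set (state R) :=
  [set x | [/\ 0 <= tau x <= d,
               exists2 n : nat, (n <= 5)%N & p x = n%:R &
               exists2 n : nat, (n <= 1)%N & q x = n%:R]].

(* x_eps = (eps, x), with eps = (eps_tau, eps_a) as a column vector *)
Definition state_eps (R : realType) : Type := ('cV[R]_2 * state R)%type.

Definition X_eps (R : realType) (d : R) : set (state_eps R) :=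
  [set z | X d z.2].

(** The data of the hybrid system *)

Definition F (R : realType) (x : state R) : state R :=
  (a_i x, a_k x, 0, 0, -1, 0, 0, 0, 0).

Definition K_o (R : realType) (m : 'rV[R]_6) : R :=
  2^-1 * (entry m 4 - entry m 5 - entry m 2 + entry m 3).

Definition K_a (R : realType) (mu : R) (m : 'rV[R]_6) (t_k : R) : R :=
  mu * ((entry m 1 - entry m 5) - (t_k - entry m 4)).

Definition G1 (R : realType) (d : R) (x : state R) : state R :=
  (tau_i x, tau_k x, a_i x, a_k x, d,
   push (tau_i x) (m_i x), m_k x, p x + 1, 1).

Definition G2 (R : realType) (c : R) (x : state R) : state R :=
  (tau_i x, tau_k x, a_i x, a_k x, c,
   m_i x, push (tau_k x) (m_i x), p x + 1, 0).

Definition G3 (R : realType) (d : R) (x : state R) : state R :=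
  (tau_i x, tau_k x, a_i x, a_k x, d,
   m_i x, push (tau_k x) (m_k x), p x + 1, 1).

Definition G4 (R : realType) (c : R) (x : state R) : state R :=
  (tau_i x, tau_k x, a_i x, a_k x, c,
   push (tau_i x) (m_k x), m_k x, p x + 1, 0).

Definition G5 (R : realType) (d : R) (x : state R) : state R :=
  (tau_i x, tau_k x, a_i x, a_k x, d,
   push (tau_i x) (m_i x), m_k x, p x + 1, 1).

Definition G6 (R : realType) (c mu : R) (x : state R) : state R :=
  (tau_i x, tau_k x - K_o (m_i x), a_i x, a_k x + K_a mu (m_i x) (tau_k x), c,
   m_i x, push (tau_k x) (m_i x), 0, 0).

Definition A_f (R : realType) : 'M[R]_2 := delta_mx 0 1.

Definition F_eps (R : realType) (z : state_eps R) : state_eps R :=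
  (A_f R *m z.1, F z.2).

Definition C_eps1 (R : realType) (c d : R) : set (state_eps R) :=
  X_eps d `&` [set z | q z.2 = 0 /\ 0 <= tau z.2 <= c].

Definition C_eps2 (R : realType) (d : R) : set (state_eps R) :=
  X_eps d `&` [set z | q z.2 = 1 /\ 0 <= tau z.2 <= d].

Definition C_eps (R : realType) (c d : R) : set (state_eps R) :=
  C_eps1 c d `|` C_eps2 d.

Definition D_epsl (R : realType) (d : R) (l : nat) : set (state_eps R) :=
  X_eps d `&` [set z | tau z.2 = 0 /\ p z.2 = l%:R - 1].

Definition D_eps (R : realType) (d : R) : set (state_eps R) :=
  \bigcup_(l in [set l | (1 <= l <= 6)%N]) D_epsl d l.

Definition eps_correction (R : realType) (mu : R) (x : state R) : 'cV[R]_2 :=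
  \col_(i < 2) if i == 0 then K_o (m_i x) else - K_a mu (m_i x) (tau_k x).

Definition G_epsl (R : realType) (c d mu : R) (l : nat) (z : state_eps R) :
    state_eps R :=
  match l with
  | 1%N => (z.1, G1 d z.2)
  | 2%N => (z.1, G2 c z.2)
  | 3%N => (z.1, G3 d z.2)
  | 4%N => (z.1, G4 c z.2)
  | 5%N => (z.1, G5 d z.2)
  | 6%N => (z.1 + eps_correction mu z.2, G6 c mu z.2)
  | _ => z
  end.

(* The sets D_epsl d l are pairwise disjoint; off their union the value is
   irrelevant and set to z. *)
Definition G_eps (R : realType) (c d mu : R) (z : state_eps R) : state_eps R :=
  if `[< D_epsl d 1 z >] then G_epsl c d mu 1 z
  else if `[< D_epsl d 2 z >] then G_epsl c d mu 2 z
  else if `[< D_epsl d 3 z >] then G_epsl c d mu 3 z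
  else if `[< D_epsl d 4 z >] then G_epsl c d mu 4 z
  else if `[< D_epsl d 5 z >] then G_epsl c d mu 5 z
  else if `[< D_epsl d 6 z >] then G_epsl c d mu 6 z
  else z.

Definition H_eps (R : realType) (c d mu : R) : hybrid_system (state_eps R) :=
  HybridSystem (C_eps c d) (@F_eps R) (@D_eps R d) (G_eps c d mu).

(** The set M *)

Definition rho_i (R : realType) (c d : R) (z : state_eps R) (beta : R) : R :=
  let x := z.2 in
  tau_i x - a_i x * ((1 - q x) * c + q x * d - tau x) - a_i x * beta.

Definition rho_k (R : realType) (c d : R) (z : state_eps R) (beta : R) : R :=
  let x := z.2 in
  tau_k x - a_k x * ((1 - q x) * c + q x * d - tau x) - a_k x * beta.

Definition M1 (R : realType) (d : R) : set (state_eps R) :=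
  X_eps d `&` [set z | p z.2 = 0 /\ q z.2 = 0].

Definition M2 (R : realType) (c d : R) : set (state_eps R) :=
  X_eps d `&` [set z | (p z.2 = 1 /\ q z.2 = 1) /\
    entry (m_i z.2) 1 = rho_i c d z 0].

Definition M3 (R : realType) (c d : R) : set (state_eps R) :=
  X_eps d `&` [set z | (p z.2 = 2 /\ q z.2 = 0) /\
    (entry (m_k z.2) 1 = rho_k c d z 0 /\
     entry (m_k z.2) 2 = rho_i c d z d)].

Definition M4 (R : realType) (c d : R) : set (state_eps R) :=
  X_eps d `&` [set z | (p z.2 = 3 /\ q z.2 = 1) /\
    [/\ entry (m_k z.2) 1 = rho_k c d z 0,
        entry (m_k z.2) 2 = rho_k c d z c &
        entry (m_k z.2) 3 = rho_i c d z (c + d)]].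

Definition M5 (R : realType) (c d : R) : set (state_eps R) :=
  X_eps d `&` [set z | (p z.2 = 4 /\ q z.2 = 0) /\
    [/\ entry (m_i z.2) 1 = rho_i c d z 0,
        entry (m_i z.2) 2 = rho_k c d z d,
        entry (m_i z.2) 3 = rho_k c d z (c + d) &
        entry (m_i z.2) 4 = rho_i c d z (2 * d + c)]].

Definition M6 (R : realType) (c d : R) : set (state_eps R) :=
  X_eps d `&` [set z | (p z.2 = 5 /\ q z.2 = 1) /\
    [/\ entry (m_i z.2) 1 = rho_i c d z 0,
        entry (m_i z.2) 2 = rho_i c d z c,
        entry (m_i z.2) 3 = rho_k c d z (c + d),
        entry (m_i z.2) 4 = rho_k c d z (2 * c + d) &
        entry (m_i z.2) 5 = rho_i c d z (2 * c + 2 * d)]].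

Definition M (R : realType) (c d : R) : set (state_eps R) :=
  M1 d `|` M2 c d `|` M3 c d `|` M4 c d `|` M5 c d `|` M6 c d.

(* Main.v *)
Require Import Defs.
From HB Require Import structures.
From mathcomp Require Import all_boot all_order all_algebra.
From mathcomp Require Import all_classical all_reals all_analysis.
From mathcomp Require Import measurable_realfun ring lra.

Set Implicit Arguments.
Unset Strict Implicit.
Unset Printing Implicit Defensive.

Import Order.TTheory GRing.Theory Num.Theory.
Import numFieldNormedType.Exports.

Local Open Scope classical_set_scope.
Local Open Scope ring_scope.

(** Why the solutions end up in M.

    Along a flow the clock tau decreases at unit rate, so a flow interval lasts
    at most d, and after j jumps the elapsed time is at most (j + 1) d.  Hence a
    late hybrid time t + j forces many jumps to have occurred.  Each jump raises
    p by one until p = 5, from where the next jump resets p and q to 0, that is,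
    enters M1.  Thus six jumps suffice to enter M, whatever the initial state.

    Once in M, the solution stays there.  The quantities rho_i(x, beta) and
    rho_k(x, beta) extrapolate tau_i, resp. tau_k, back to a moment that is fixed
    along a flow: c - tau or d - tau, according to q, is the time elapsed since
    the clock read c or d, and tau_i grows at the constant rate a_i.  So they
    are constant along a flow, as are the stored timestamps m^i and m^k
    (rho_i_flowed, rho_k_flowed, M_flowed).  At a jump from M_n to M_(n+1) the
    old timestamps are shifted by one place and the reference moment of rho is
    reset to the present, that is, advances by c or d, which is the increment in
    beta between the two sets (jump_M2 to jump_M6).  The bookkeeping is done by
    the predicate on_course j: either M has been reached or p >= j.

    The analytic input is that a solution is only absolutely continuous, with the
    differential equation holding almost everywhere, so that even the affine form
    of its flow (flowed_ae_primitive) rests on the theorem that an absolutely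
    continuous function with zero derivative almost everywhere is constant
    (ac_ae_derive0_eq).  This is proved without integration: cover the exceptional
    null set by an open set U of small measure, and walk from a to b by small
    steps.  A step around a point where the derivative vanishes changes f by a
    small multiple of its length; the other steps are disjoint intervals inside
    U, whose total contribution absolute continuity makes small.  The walk is
    organised by real_induction. *)

(** * Absolutely continuous functions with zero derivative almost everywhere *)

(** Compactness of [a, b] as an induction principle: at the supremum of the
    reachable points, a step across it reaches further. *)
Lemma real_induction (R : realType) (a b : R) (P : R -> Prop) : a <= b -> P a ->
  (forall t, a <= t <= b -> exists2 r, 0 < r &
     forall x y, a <= x <= t -> t <= y <= b -> t - r < x -> y < t + r ->
       P x -> P y) ->
  P b.
Proof.
move=> ab Pa step; pose S := [set x | a <= x <= b /\ P x].
have Sa : S a by split; rewrite ?lexx.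
have ubS : ubound S b by move=> x [/andP[]].
have supS : has_sup S by split; [exists a | exists b].
have leS x : S x -> x <= sup S by exact: (ub_le_sup supS.2).
have st : a <= sup S <= b by apply/andP; split;
    [exact: leS | apply: ge_sup => //; exists a].
have [r r0 jump] := step _ st; move/andP: st => [as_ sb].
have [x [/andP[ax xb] Px] sx] := sup_adherent r0 supS.
have xs : x <= sup S by apply: leS; rewrite /S /= ax xb.
have reach y : sup S <= y -> y <= b -> y < sup S + r -> P y.
  by move=> sy yb yr; apply: (jump x y) => //; rewrite ?ax ?sy.
have [bs|slt] := leP b (sup S + r / 2); first by apply: reach => //; lra.
have Sy : S (sup S + r / 2).
  by split; [lra | apply: reach; lra].
have : sup S + r / 2 <= sup S by exact: leS.
lra.
Qed.

(** Stated for increments because the covering argument below takes steps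
    across t, with both ends close to t. *)
Lemma is_derive_increment (R : realType) (V : normedModType R) (f : R -> V)
    (t : R) (v : V) (e : R) : is_derive t 1 f v -> 0 < e ->
  exists2 r, 0 < r & forall y, `|y - t| < r ->
    `|f y - f t - (y - t) *: v| <= e * `|y - t|.
Proof.
move=> [df fv] e0.
have : h^-1 *: ((f \o shift t) (h *: 1) - f t) @[h --> 0^'] --> v by rewrite -fv.
move=> /cvgrPdist_le /(_ e e0) [r r0 rP]; exists r => // y yr.
have [->|yt] := eqVneq y t; first by rewrite !subrr scale0r subr0 !normr0 mulr0.
have h0 : y - t != 0 by rewrite subr_eq0.
have := rP (y - t); rewrite /= sub0r normrN => /(_ yr h0).
rewrite [_ *: 1]mulr1 subrK => H.
rewrite distrC (_ : _ - _ = (y - t) *: (v - (y - t)^-1 *: (f y - f t))).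
  by rewrite normrZ mulrC ler_wpM2r.
by rewrite scalerBr scalerA mulfV// scale1r.
Qed.

Lemma total_length_le (R : realType) (U : set R) (n : nat) (I : 'I_n -> R * R) :
  measurable U -> (forall k, (I k).1 <= (I k).2) ->
  trivIset setT (fun k => `](I k).1, (I k).2[%classic : set R) ->
  (forall k, `](I k).1, (I k).2[ `<=` U) ->
  ((\sum_(k < n) ((I k).2 - (I k).1))%:E <= (@lebesgue_measure R) U)%E.
Proof.
move=> mU leI tI IU.
pose J k := `](I k).1, (I k).2[%classic : set R.
have mJ k : measurable (J k) by exact: measurable_itv.
have -> : (\sum_(k < n) ((I k).2 - (I k).1))%:E =
    (\sum_(k < n | true) lebesgue_measure (J k))%E.
  rewrite -sumEFin; apply: eq_bigr => k _.
  rewrite lebesgue_measure_itv /= lte_fin; case: ltP => // le21.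
  by rewrite (@le_anti _ _ (I k).1 (I k).2) ?leI// subrr.
rewrite -measure_bigsetU_ord//; apply: le_measure; rewrite ?inE//.
  by apply: bigsetU_measurable => k _; exact: mJ.
by elim/big_ind: _ => // [A B AU BU|k _]; [rewrite subUset | exact: IU].
Qed.

Lemma trivIset_pairwise_itv (R : realType) (s : seq (R * R)) :
  pairwise (fun I J => J.2 <= I.1) s ->
  trivIset setT (fun k : 'I_(size s) =>
    `](tnth (in_tuple s) k).1, (tnth (in_tuple s) k).2[%classic : set R).
Proof.
move=> /(pairwiseP (0, 0)) sP; apply/trivIsetP => i j _ _.
wlog ij : i j / (i < j)%N.
  move=> wl; rewrite neq_ltn => /orP[] lij; first by apply: wl => //; rewrite neq_ltn lij.
  by rewrite setIC; apply: wl => //; rewrite neq_ltn lij.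
move=> _; rewrite -subset0 => x /=; rewrite !in_itv !(tnth_nth (0, 0)) /=.
move=> [/andP[ix _] /andP[_ xj]]; have := sP i j (ltn_ord i) (ltn_ord j) ij.
lra.
Qed.

(** By absolute continuity, f varies arbitrarily little over a null set; at all
    other points it is locally almost constant. *)
Theorem ac_ae_derive0_eq (R : realType) (V : normedModType R) (a b : R)
    (f : R -> V) : a <= b -> absolutely_continuous_on a b f ->
  {ae (@lebesgue_measure R), forall t, a <= t <= b -> is_derive t 1 f 0} ->
  f b = f a.
Proof.
move=> ab acf [A [mA A0 NA]].
(* A nonzero increment would exceed half of its own norm. *)
suff small e : 0 < e -> `|f b - f a| <= e.
  apply/eqP; rewrite -subr_eq0 -normr_eq0; apply/eqP/le_anti.
  rewrite normr_ge0 andbT leNgt; apply/negP => n0.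
  by have := small (`|f b - f a| / 2); lra.
move=> e0; have e20 : 0 < e / 2 by lra.
have [delta delta0 acP] := acf _ e20.
have A_fin : (lebesgue_measure A < +oo :> \bar R)%E by rewrite A0.
have [U [oU AU UAlt]] := lebesgue_regularity_outer mA A_fin delta0.
have mU : measurable U by exact: open_measurable.
have Ult : (lebesgue_measure U < delta%:E)%E.
  apply: le_lt_trans UAlt; rewrite -{1}(setDUK AU).
  apply: le_trans (measureU2 _ _ _) _ => //; first exact: measurableD.
  by rewrite [X in (X + _)%E]A0 add0e.
(* The slope eta makes the differentiable steps contribute at most e / 2 in
   total; the 1 avoids a division by zero when a = b. *)
pose eta := e / 2 / (b - a + 1).
have eta0 : 0 < eta by rewrite divr_gt0//; lra.
(* The list s records, latest first, the steps made so far around exceptional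
   points. *)
pose P x := exists s : seq (R * R),
  [/\ all (fun I => [&& a <= I.1, I.1 <= I.2 & I.2 <= x]) s,
      pairwise (fun I J => J.2 <= I.1) s,
      (forall I, I \in s -> `]I.1, I.2[ `<=` U) &
      `|f x - f a| <= eta * (x - a) + \sum_(I <- s) `|f I.2 - f I.1|].
suff [s [sab sdisj sU fle]] : P b.
  have le12 k : (tnth (in_tuple s) k).1 <= (tnth (in_tuple s) k).2.
    by move/all_tnthP : (sab : all _ (in_tuple s)) => /(_ k)/and3P[].
  have sum_lt : \sum_(I <- s) `|f I.2 - f I.1| < e / 2.
    rewrite big_tnth; apply: acP.
    + move=> k; move/all_tnthP : (sab : all _ (in_tuple s)) => /(_ k).
      by move=> /and3P[].
    + exact: trivIset_pairwise_itv.
    + rewrite -lte_fin; apply: le_lt_trans Ult; apply: total_length_le => //.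
        exact: trivIset_pairwise_itv.
      by move=> k; apply: sU; exact: (mem_tnth k (in_tuple s)).
  have : eta * (b - a) <= eta * (b - a + 1) by rewrite ler_pM2l//; lra.
  rewrite {2}/eta divfK; last by rewrite gt_eqF//; lra.
  lra.
have concat x y : `|f y - f a| <= `|f y - f x| + `|f x - f a|.
  by rewrite -{1}(subrK (f x) (f y)) -addrA ler_normD.
apply: (real_induction ab).
  by exists [::]; split => //; rewrite !subrr normr0 mulr0 big_nil addr0.
move=> t tab; have [At|At] := pselect (A t).
  (* An exceptional point: the step is recorded in the list. *)
  have [r /= r0 rU] := open_subball oU (AU _ At); exists (r / 2); first by lra.
  move=> x y /andP[ax xt] /andP[ty yb] rx yr [s [sax sdisj sU fle]].
  exists ((x, y) :: s); split.
  - rewrite /= ax lexx (le_trans xt ty) /=; apply: sub_all sax => I /and3P[-> ->].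
    by move=> Ix; rewrite (le_trans Ix)//; lra.
  - rewrite /= sdisj andbT; apply: sub_all sax => I /and3P[_ _]; exact.
  - move=> I; rewrite in_cons => /predU1P[-> z /=|]; last exact: sU.
    rewrite in_itv /= => /andP[xz zy].
    apply: (rU (r / 2)) => /=.
    + by rewrite sub0r normrN gtr0_norm; lra.
    + by lra.
    + by rewrite /ball /=; case: (ler0P (t - z)); lra.
  - rewrite big_cons /=; have := concat x y.
    have : eta * (x - a) <= eta * (y - a) by rewrite ler_pM2l//; lra.
    by lra.
(* A point of zero derivative: the step is paid for by eta (y - x). *)
have ft : is_derive t 1 f 0.
  by apply: contrapT => nd; apply: At; apply: NA => /= /(_ tab).
have [r r0 rP] := is_derive_increment ft eta0; exists r => //.
move=> x y /andP[ax xt] /andP[ty yb] rx yr [s [sax sdisj sU fle]].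
exists s; split => //.
  apply: sub_all sax => I /and3P[-> -> Ix] /=; lra.
have fx := rP x; have fy := rP y; rewrite !scaler0 !subr0 in fx fy.
have {}fx : `|f x - f t| <= eta * (t - x).
  have xt' : `|x - t| = t - x by rewrite distrC ger0_norm ?subr_ge0.
  by rewrite -xt' fx// xt'; lra.
have {}fy : `|f y - f t| <= eta * (y - t).
  have ty' : `|y - t| = y - t by rewrite ger0_norm ?subr_ge0.
  by rewrite -[X in eta * X]ty' fy// ty'; lra.
have fxy : `|f y - f x| <= `|f y - f t| + `|f x - f t|.
  by rewrite [`|f x - _|]distrC -{1}(subrK (f t) (f y)) -addrA ler_normD.
have := concat x y; lra.
Qed.

Lemma lebesgue_aeS (R : realType) (P Q : R -> Prop) : (forall t, P t -> Q t) ->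
  {ae (@lebesgue_measure R), forall t, P t} ->
  {ae (@lebesgue_measure R), forall t, Q t}.
Proof. by move=> PQ; apply: negligibleS => t /= nQ Pt; apply/nQ/PQ. Qed.

Lemma is_deriveE (R : realType) (V : normedModType R) (f : R -> V) (t : R)
    (v : V) : is_derive t 1 f v <->
  h^-1 *: ((f \o shift t) (h *: 1) - f t) @[h --> 0^'] --> v.
Proof.
split=> [[df <-] //|fv]; split; last exact: cvg_lim.
by apply/cvg_ex; exists v.
Qed.

Lemma is_derive_line (R : realType) (V : normedModType R) (v : V) (t : R) :
  is_derive t 1 (fun s : R => s *: v) v.
Proof.
apply/is_deriveE; apply: cvg_near_cst; near=> h => /=.
rewrite [h *: 1]mulr1 scalerDl addrK scalerA mulVf ?scale1r//.
by near: h; exact: nbhs_dnbhs_neq.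
Unshelve. all: by end_near. Qed.

Lemma absolutely_continuous_on_sub (R : realType) (V : normedModType R)
    (a b x y : R) (f : R -> V) : a <= x -> y <= b ->
  absolutely_continuous_on a b f -> absolutely_continuous_on x y f.
Proof.
move=> ax yb acf e e0; have [delta delta0 acP] := acf e e0.
exists delta => // n I Ixy; apply: acP => k; have [xI ? Iy] := Ixy k.
by split => //; [exact: le_trans ax xI | exact: le_trans Iy yb].
Qed.

Lemma absolutely_continuous_on_contract (R : realType) (V W : normedModType R)
    (a b : R) (f : R -> V) (g : R -> W) :
  (forall x y, `|g x - g y| <= `|f x - f y|) ->
  absolutely_continuous_on a b f -> absolutely_continuous_on a b g.
Proof.
move=> gf acf e e0; have [delta delta0 acP] := acf e e0.
exists delta => // n I Iab tI Idelta; apply: le_lt_trans (acP n I Iab tI Idelta).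
by apply: ler_sum => k _; exact: gf.
Qed.

Lemma absolutely_continuous_on_subline (R : realType) (V : normedModType R)
    (a b : R) (f : R -> V) (v : V) : absolutely_continuous_on a b f ->
  absolutely_continuous_on a b (fun s => f s - s *: v).
Proof.
move=> acf e e0; have e20 : 0 < e / 2 by lra.
have v0 := normr_ge0 v; have v1 : 0 < `|v| + 1 by lra.
have [delta delta0 acP] := acf _ e20.
exists (Num.min delta (e / 2 / (`|v| + 1))).
  by rewrite lt_min delta0 divr_gt0.
move=> n I Iab tI; rewrite lt_min => /andP[sum1 sum2].
have {}sum1 := acP n I Iab tI sum1.
have {}sum2 : (\sum_(k < n) ((I k).2 - (I k).1)) * `|v| <= e / 2.
  rewrite ltr_pdivlMr// in sum2; apply: le_trans (ltW sum2).
  rewrite ler_wpM2l ?lerDl// sumr_ge0// => k _.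
  by have [_ ? _] := Iab k; rewrite subr_ge0.
apply: (@le_lt_trans _ _ (\sum_(k < n) `|f (I k).2 - f (I k).1| +
    (\sum_(k < n) ((I k).2 - (I k).1)) * `|v|)); last by lra.
rewrite mulr_suml -big_split /=; apply: ler_sum => k _.
rewrite (_ : _ - _ - _ =
    f (I k).2 - f (I k).1 - ((I k).2 - (I k).1) *: v); last first.
  by rewrite scalerBl !opprB addrACA [in RHS]addrACA [in RHS](addrC (- _)).
apply: le_trans (ler_normB _ _) _; rewrite normrZ ger0_norm//.
by have [_ ? _] := Iab k; rewrite subr_ge0.
Qed.

(** * Primitives almost everywhere *)

(** The sense in which a hybrid arc solves its differential equation on a
    compact piece of a flow interval. *)
Definition ae_primitive (R : realType) (V : normedModType R) (a b : R)
    (f g : R -> V) : Prop :=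
  absolutely_continuous_on a b f /\
  {ae (@lebesgue_measure R), forall t, a <= t <= b -> is_derive t 1 f (g t)}.

Lemma ae_primitive_eq (R : realType) (V : normedModType R) (a b : R)
    (f g h : R -> V) : (forall t, a <= t <= b -> g t = h t) ->
  ae_primitive a b f g -> ae_primitive a b f h.
Proof.
move=> gh [acf aef]; split => //; apply: lebesgue_aeS aef => t ft tab.
by rewrite -gh//; exact: ft.
Qed.

Lemma ae_primitive_sub (R : realType) (V : normedModType R) (a b x y : R)
    (f g : R -> V) : a <= x -> y <= b ->
  ae_primitive a b f g -> ae_primitive x y f g.
Proof.
move=> ax yb [acf aef]; split; first exact: absolutely_continuous_on_sub acf.
apply: lebesgue_aeS aef => t ft /andP[xt ty]; apply: ft.
by rewrite (le_trans ax xt) (le_trans ty yb).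
Qed.

(** Subtracting the line of slope v reduces this to a zero derivative. *)
Theorem ae_primitive_cst (R : realType) (V : normedModType R) (a b : R)
    (f : R -> V) (v : V) : a <= b -> ae_primitive a b f (fun=> v) ->
  f b = f a + (b - a) *: v.
Proof.
move=> ab [acf aef].
have : f b - b *: v = f a - a *: v.
  apply: (@ac_ae_derive0_eq _ _ a b (fun s => f s - s *: v)) => //.
    exact: absolutely_continuous_on_subline.
  apply: lebesgue_aeS aef => t ft tab; have {}ft := ft tab.
  by rewrite -(subrr v); apply: is_deriveB; exact: is_derive_line.
by move=> /(canRL (subrK _)) ->; rewrite scalerBl addrAC addrA.
Qed.

(** Projections are linear and do not increase the norm, so the components of
    a primitive are primitives; this gives access to each coordinate of the
    state. *)
Lemma ae_primitive_fst (R : realType) (V W : normedModType R) (a b : R)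
    (f g : R -> V * W) : ae_primitive a b f g ->
  ae_primitive a b (fst \o f) (fst \o g).
Proof.
move=> [acf aef]; split.
  apply: absolutely_continuous_on_contract acf => x y.
  by rewrite prod_normE le_max lexx.
apply: lebesgue_aeS aef => t ft tab; have /is_deriveE {}ft := ft tab.
apply/is_deriveE.
exact: (@cvg_comp _ _ _ _ fst _ _ _ ft (@cvg_fst _ _ _ _ _)).
Qed.

Lemma ae_primitive_snd (R : realType) (V W : normedModType R) (a b : R)
    (f g : R -> V * W) : ae_primitive a b f g ->
  ae_primitive a b (snd \o f) (snd \o g).
Proof.
move=> [acf aef]; split.
  apply: absolutely_continuous_on_contract acf => x y.
  by rewrite prod_normE le_max lexx orbT.
apply: lebesgue_aeS aef => t ft tab; have /is_deriveE {}ft := ft tab.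
apply/is_deriveE.
exact: (@cvg_comp _ _ _ _ snd _ _ _ ft (@cvg_snd _ _ _ _ _)).
Qed.

(** * The flow of the error system *)

Definition flowed (R : realType) (h : R) (z z' : state_eps R) : Prop :=
  [/\ [/\ tau_i z'.2 = tau_i z.2 + h * a_i z.2,
          tau_k z'.2 = tau_k z.2 + h * a_k z.2,
          a_i z'.2 = a_i z.2, a_k z'.2 = a_k z.2 &
          tau z'.2 = tau z.2 - h],
      m_i z'.2 = m_i z.2, m_k z'.2 = m_k z.2,
      p z'.2 = p z.2 & q z'.2 = q z.2].

(** The vector field is triangular: a_i and a_k have zero derivative, hence are
    constant, and only then do tau_i and tau_k have constant derivatives. *)
Lemma flowed_ae_primitive (R : realType) (a b : R) (f : R -> state_eps R) :
  a <= b -> ae_primitive a b f (fun t => F_eps (f t)) ->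
  flowed (b - a) (f a) (f b).
Proof.
move=> ab /ae_primitive_snd P0.
have P1 := ae_primitive_fst P0; have P2 := ae_primitive_fst P1.
have P3 := ae_primitive_fst P2; have P4 := ae_primitive_fst P3.
have P5 := ae_primitive_fst P4; have P6 := ae_primitive_fst P5.
have P7 := ae_primitive_fst P6.
have aiE s : a <= s <= b -> a_i (f s).2 = a_i (f a).2.
  move=> /andP[as_ sb].
  have := ae_primitive_cst as_ (ae_primitive_sub (lexx a) sb (ae_primitive_snd P6)).
  by rewrite scaler0 addr0.
have akE s : a <= s <= b -> a_k (f s).2 = a_k (f a).2.
  move=> /andP[as_ sb].
  have := ae_primitive_cst as_ (ae_primitive_sub (lexx a) sb (ae_primitive_snd P5)).
  by rewrite scaler0 addr0.
have abb : a <= b <= b by rewrite ab lexx.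
split; first split; rewrite ?aiE ?akE//.
- exact: (ae_primitive_cst ab (ae_primitive_eq aiE (ae_primitive_fst P7))).
- exact: (ae_primitive_cst ab (ae_primitive_eq akE (ae_primitive_snd P7))).
- by have := ae_primitive_cst ab (ae_primitive_snd P4); rewrite [_ *: _]mulrN1.
- by have := ae_primitive_cst ab (ae_primitive_snd P3); rewrite scaler0 addr0.
- by have := ae_primitive_cst ab (ae_primitive_snd P2); rewrite scaler0 addr0.
- by have := ae_primitive_cst ab (ae_primitive_snd P1); rewrite scaler0 addr0.
- by have := ae_primitive_cst ab (ae_primitive_snd P0); rewrite scaler0 addr0.
Qed.

Section invariance.
Variables (R : realType) (c d mu : R).
Hypotheses (c_gt0 : 0 < c) (c_le_d : c <= d).
Implicit Types (z : state_eps R) (h beta : R) (l n j : nat).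

(** The gain a_i h of tau_i is offset by the loss h of tau. *)
Lemma rho_i_flowed h z z' beta : flowed h z z' ->
  rho_i c d z' beta = rho_i c d z beta.
Proof. by move=> [[ti _ ai _ ta] _ _ _ qE]; rewrite /rho_i ti ai ta qE; ring. Qed.

Lemma rho_k_flowed h z z' beta : flowed h z z' ->
  rho_k c d z' beta = rho_k c d z beta.
Proof. by move=> [[_ tk _ ak ta] _ _ _ qE]; rewrite /rho_k tk ak ta qE; ring. Qed.

Lemma M_flowed h z z' : flowed h z z' -> X_eps d z' -> M c d z -> M c d z'.
Proof.
move=> zz' Xz'; have [_ miE mkE pE qE] := zz'.
have riE beta := rho_i_flowed beta zz'; have rkE beta := rho_k_flowed beta zz'.
rewrite /M /M1 /M2 /M3 /M4 /M5 /M6 /setU /setI /= miE mkE pE qE !riE !rkE.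
by case=> [[[[[|]|]|]|]|] [_ Mz]; [do 5 left|do 4 left; right|do 3 left; right
  |do 2 left; right|left; right|right].
Qed.

(** * The jumps of the error system *)

Lemma C_eps_X z : C_eps c d z -> X_eps d z.
Proof. by case=> [][]. Qed.

Lemma D_eps_X z : D_eps d z -> X_eps d z.
Proof. by case=> l _ []. Qed.

Lemma D_eps_p n z : D_eps d z -> p z.2 = n%:R -> D_epsl d n.+1 z.
Proof. by move=> [l _ [Xz [ta _]]] pn; do 2?split => //; rewrite pn -natr1 addrK. Qed.

(** The cascade of tests in G_eps is unambiguous: p determines the jump. *)
Lemma G_epsE l z : (1 <= l <= 6)%N -> D_epsl d l z ->
  G_eps c d mu z = G_epsl c d mu l z.
Proof.
move=> l16 Dl; have uniq k : D_epsl d k z -> k = l.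
  move=> [_ [_ pk]]; have [_ [_ pl]] := Dl; apply/eqP; rewrite -(eqr_nat R).
  by apply/eqP/(addIr (-1)); rewrite -pk -pl.
have nD k : k != l -> `[< D_epsl d k z >] = false.
  by move=> kl; apply: asboolF => /uniq/eqP; apply/negP.
have Dl' : `[< D_epsl d l z >] by apply/asboolP.
move: l16 Dl' nD; rewrite /G_eps; case: l Dl uniq => [//|].
by do 6 (case=> [_ _ _ Dl nD|]; first by rewrite ?Dl ?nD).
Qed.

Lemma entry_push1 (t : R) (m : 'rV[R]_6) : entry (push t m) 1 = t.
Proof. by rewrite /entry mxE inordK. Qed.

Lemma entry_pushS (t : R) (m : 'rV[R]_6) l : (0 < l < 6)%N ->
  entry (push t m) l.+1 = entry m l.
Proof. by case: l => // l /= l6; rewrite {1}/entry mxE inordK. Qed.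

Lemma X_eps_after (e : 'cV[R]_2) (ti tk ai ak t : R) (mi mk : 'rV[R]_6) (n : nat)
    (b : R) : 0 <= t <= d -> (n <= 5)%N -> b = 0 \/ b = 1 ->
  X_eps d (e, (ti, tk, ai, ak, t, mi, mk, n%:R, b)).
Proof.
move=> td n5 b01; split => //; first by exists n.
by case: b01 => ->; [exists 0%N | exists 1%N].
Qed.

Lemma clock_d : 0 <= d <= d.
Proof. by rewrite lexx (le_trans (ltW c_gt0) c_le_d). Qed.

Lemma clock_c : 0 <= c <= d.
Proof. by rewrite c_le_d andbT ltW. Qed.

Lemma jump_X z : D_eps d z -> X_eps d (G_eps c d mu z).
Proof.
move=> [l /= l16 Dl]; rewrite (G_epsE l16 Dl); have [_ [_ pz]] := Dl.
have cin := clock_c; have din := clock_d.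
have pS : p z.2 + 1 = l%:R by rewrite pz subrK.
case: l l16 Dl pz pS => [//|]; do 5 (case=> [_ _ _ pS|];
  first by rewrite /= /G1 /G2 /G3 /G4 /G5 pS; apply: X_eps_after => //;
  by [left | right]).
by case=> [_ _ _ _|//]; apply: (@X_eps_after _ _ _ _ _ _ _ _ 0) => //; left.
Qed.

Lemma jump_p z n : D_eps d z -> p z.2 = n%:R -> (n < 5)%N ->
  p (G_eps c d mu z).2 = n.+1%:R.
Proof.
move=> Dz pn n5; rewrite (@G_epsE n.+1)//; last exact: D_eps_p.
  by rewrite -natr1 -pn; move: n n5 {pn}; do 5 case=> //.
by rewrite /= (leq_trans n5).
Qed.

(** The only jump out of p = 5 is the resetting one, and M1 constrains no
    timestamp: this is how M is entered from an arbitrary state. *)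
Lemma jump_M1 z : D_eps d z -> p z.2 = 5 -> M1 d (G_eps c d mu z).
Proof.
move=> Dz pz; split; first exact: jump_X.
by rewrite (@G_epsE 6)//; exact: (D_eps_p (n := 5)).
Qed.

Lemma D_eps_tau z : D_eps d z -> tau z.2 = 0.
Proof. by case=> l _ [_ []]. Qed.

(** In this lemma and the next four, the term (1 - q) c + q d - tau of rho drops
    to 0 at the jump, where it was c or d because tau = 0.  The new entry is the
    current time, so its beta is 0, and the beta of each older entry grows by
    that c or d. *)
Lemma jump_M2 z : D_eps d z -> M1 d z -> M2 c d (G_eps c d mu z).
Proof.
move=> Dz [_ [pz qz]]; split; first exact: jump_X.
rewrite (@G_epsE 1)//; last exact: (@D_eps_p 0).
rewrite /= /rho_i /rho_k /tau_i /tau_k /a_i /a_k /tau /m_i /m_k /p /q /=.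
by rewrite entry_push1 pz; split; [split; ring | ring].
Qed.

Lemma jump_M3 z : D_eps d z -> M2 c d z -> M3 c d (G_eps c d mu z).
Proof.
move=> Dz [_ [[pz qz] mi1]]; split; first exact: jump_X.
have ta := D_eps_tau Dz; rewrite (@G_epsE 2)//; last exact: (@D_eps_p 1).
rewrite /= /rho_i /rho_k /tau_i /tau_k /a_i /a_k /tau /m_i /m_k /p /q /=.
rewrite entry_push1 entry_pushS// mi1 /rho_i /rho_k pz qz ta.
by split; repeat split; ring.
Qed.

Lemma jump_M4 z : D_eps d z -> M3 c d z -> M4 c d (G_eps c d mu z).
Proof.
move=> Dz [_ [[pz qz] [mk1 mk2]]]; split; first exact: jump_X.
have ta := D_eps_tau Dz; rewrite (@G_epsE 3)//; last exact: (@D_eps_p 2).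
rewrite /= /rho_i /rho_k /tau_i /tau_k /a_i /a_k /tau /m_i /m_k /p /q /=.
rewrite entry_push1 !entry_pushS// mk1 mk2 /rho_i /rho_k pz qz ta.
by split; repeat split; ring.
Qed.

Lemma jump_M5 z : D_eps d z -> M4 c d z -> M5 c d (G_eps c d mu z).
Proof.
move=> Dz [_ [[pz qz] [mk1 mk2 mk3]]]; split; first exact: jump_X.
have ta := D_eps_tau Dz; rewrite (@G_epsE 4)//; last exact: (@D_eps_p 3).
rewrite /= /rho_i /rho_k /tau_i /tau_k /a_i /a_k /tau /m_i /m_k /p /q /=.
rewrite entry_push1 !entry_pushS// mk1 mk2 mk3 /rho_i /rho_k pz qz ta.
by split; repeat split; ring.
Qed.

Lemma jump_M6 z : D_eps d z -> M5 c d z -> M6 c d (G_eps c d mu z).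
Proof.
move=> Dz [_ [[pz qz] [mi1 mi2 mi3 mi4]]]; split; first exact: jump_X.
have ta := D_eps_tau Dz; rewrite (@G_epsE 5)//; last exact: (@D_eps_p 4).
rewrite /= /rho_i /rho_k /tau_i /tau_k /a_i /a_k /tau /m_i /m_k /p /q /=.
rewrite entry_push1 !entry_pushS// mi1 mi2 mi3 mi4 /rho_i /rho_k pz qz ta.
by split; repeat split; ring.
Qed.

Lemma jump_M z : D_eps d z -> M c d z -> M c d (G_eps c d mu z).
Proof.
move=> Dz; case=> [[[[[Mz|Mz]|Mz]|Mz]|Mz]|Mz].
- by do 4 left; right; exact: jump_M2.
- by do 3 left; right; exact: jump_M3.
- by do 2 left; right; exact: jump_M4.
- by left; right; exact: jump_M5.
- by right; exact: jump_M6.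
- by do 5 left; apply: jump_M1 => //; case: Mz => _ [[]].
Qed.

(** * Solutions *)

(** Before M is reached, every jump increments p; as p <= 5 on the state space,
    the second alternative is void once j >= 6. *)
Definition on_course j z := X_eps d z /\ (M c d z \/ j%:R <= p z.2).

Lemma on_course_flowed j h z z' : flowed h z z' -> X_eps d z' ->
  on_course j z -> on_course j z'.
Proof.
move=> zz' Xz' [_ [Mz|jp]]; split => //; [left; exact: (M_flowed zz') | right].
by have [_ _ _ -> _] := zz'.
Qed.

Lemma on_course_jump j z : D_eps d z -> on_course j z ->
  on_course j.+1 (G_eps c d mu z).
Proof.
move=> Dz [[_ [n n5 pn] _] Mz]; split; first exact: jump_X.
case: Mz => [Mz|jn]; first by left; exact: jump_M.
have [n5'|n_lt5] := eqVneq n 5%N.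
  by left; do 5 left; apply: jump_M1 => //; rewrite pn n5'.
right; rewrite (jump_p Dz pn); last by rewrite ltn_neqAle n_lt5.
by rewrite ler_nat ltnS -(ler_nat R) -pn.
Qed.

Lemma on_course_M j z : (6 <= j)%N -> on_course j z -> M c d z.
Proof.
move=> j6 [[_ [n n5 ->] _] [//|]]; rewrite ler_nat => jn.
by have := leq_trans j6 (leq_trans jn n5).
Qed.

Variable phi : hybrid_arc (state_eps R).
Hypothesis phi_sol : solution (H_eps c d mu) phi.

(** The flow condition is imposed only inside the flow interval, so that
    tau >= 0 at the right end b has to be derived: if tau were negative there, it
    would already be negative slightly before b. *)
Lemma solution_flowed (a b : R) j : a <= b ->
  (forall t, a <= t <= b -> arc_dom phi (t, j)) -> X_eps d (phi a j) ->
  flowed (b - a) (phi a j) (phi b j) /\ X_eps d (phi b j).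
Proof.
move=> ab domab Xa; have [_ _ acphi Fphi _] := phi_sol.
have [C_int aephi] := Fphi j.
have fl u : a <= u <= b -> flowed (u - a) (phi a j) (phi u j).
  move=> /andP[au ub]; apply: (@flowed_ae_primitive _ a u (phi ^~ j)) => //.
  apply: (@ae_primitive_sub _ _ a b) => //; split.
    apply: acphi => // t /=; rewrite in_itv /=; exact: domab.
  by apply: lebesgue_aeS aephi => t ft tab; apply: ft; exact: domab.
have flb := fl b; rewrite ab lexx in flb; have {}flb := flb isT; split=> //.
have [/andP[ta0 tad] pa qa] := Xa.
have [[_ _ _ _ taub] _ _ pb qb] := flb.
rewrite /X_eps /X /= pb qb; split=> //; rewrite taub.
apply/andP; split; last by lra.
rewrite leNgt; apply/negP => tneg.
(* Halfway between the moment where tau vanishes and b. *)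
pose u := a + (tau (phi a j).2 + (b - a)) / 2.
have au : a < u by rewrite /u; lra.
have ub : u < b by rewrite /u; lra.
have Cu : C_eps c d (phi u j).
  apply: C_int; have : \forall x \near u, x \in `]a, b[ by
    apply: near_in_itvoo; rewrite in_itv /= au ub.
  apply: filterS => x; rewrite in_itv /= => /andP[ax xb].
  by apply: domab; rewrite !ltW.
have [/andP[tu0 _] _ _] := C_eps_X Cu.
have [[_ _ _ _ tauu] _ _ _ _] : flowed (u - a) (phi a j) (phi u j).
  by apply: fl; rewrite !ltW.
move: tu0; rewrite tauu /u; lra.
Qed.

(** Each flow uses up at most the initial value tau <= d of the clock, whence
    the bound on t. *)
Lemma solution_on_course (t : R) j : arc_dom phi (t, j) ->
  on_course j (phi t j) /\ t <= j.+1%:R * d.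
Proof.
have [[dom0 domP] [_ init] _ _ jump] := phi_sol.
move=> Etj; have t0 := dom0 _ Etj; have [s [s0 smon sE]] := domP _ _ Etj.
have dom i u : (i <= j)%N -> s i <= u <= s i.+1 -> arc_dom phi (u, i).
  move=> ij us; suff [] : (arc_dom phi `&` (`[0, t] `*` `I_j.+1)) (u, i) by [].
  by rewrite sE; exists i => //; split => //=; rewrite in_itv.
have main i : (i <= j)%N -> forall u, s i <= u <= s i.+1 ->
    on_course i (phi u i) /\ u <= i.+1%:R * d.
  have seg k : (k <= j)%N -> on_course k (phi (s k) k) -> s k <= k%:R * d ->
      forall u, s k <= u <= s k.+1 ->
      on_course k (phi u k) /\ u <= k.+1%:R * d.
    move=> kj oc skd u /andP[sku us].
    have [fl Xu] : flowed (u - s k) (phi (s k) k) (phi u k) /\ X_eps d (phi u k).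
      apply: (solution_flowed _ _ oc.1) => // v /andP[skv vu]; apply: dom => //.
      by rewrite skv (le_trans vu).
    split; first exact: (on_course_flowed fl).
    have [[_ _ _ _ tauu] _ _ _ _] := fl.
    have [/andP[_ tad] _ _] := oc.1; have [/andP[tu0 _] _ _] := Xu.
    rewrite -natr1 mulrDl mul1r; lra.
  elim: i => [|i IH] ij u us.
    apply: seg us => //; last by rewrite s0 mul0r.
    rewrite s0; have X0 : X_eps d (phi 0 0%N).
      by case: init => [/C_eps_X|/D_eps_X].
    by split => //; right; have [_ [n _ ->] _] := X0; exact: ler0n.
  have si : s i <= s i.+1 <= s i.+1 by rewrite smon ?lexx// ltnW.
  have [oc sd] := IH (ltnW ij) _ si.
  have [] := jump (s i.+1) i (dom _ _ (ltnW ij) si).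
    by apply: dom => //; rewrite lexx smon.
  by move=> Dz Gz; apply: seg us => //; rewrite Gz; exact: on_course_jump.
apply: (main j) => //; have : (arc_dom phi `&` (`[0, t] `*` `I_j.+1)) (t, j).
  by split => //; split => //=; rewrite in_itv /= lexx andbT.
by rewrite sE => -[i _ [/= + ->]]; rewrite in_itv.
Qed.
End invariance.

Theorem lemma4p4 (R : realType) (c d mu : R) (c_gt0 : 0 < c) (c_le_d : c <= d)
    (mu_gt0 : 0 < mu) (phi : hybrid_arc (state_eps R)) :
  maximal_solution (H_eps c d mu) phi ->
  exists2 Tstar : R, 0 <= Tstar &
    forall (t : R) (j : nat), arc_dom phi (t, j) -> Tstar <= t + j%:R ->
      M c d (phi t j).
Proof.
move=> [phi_sol _]; have d_gt0 := lt_le_trans c_gt0 c_le_d.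
(* With at most five jumps, t <= 6 d and t + j <= 6 d + 5. *)
exists (6 * d + 6); first by lra.
move=> t j Etj late.
have [oc td] := solution_on_course c_gt0 c_le_d phi_sol Etj.
apply: on_course_M oc; rewrite leqNgt; apply/negP; rewrite ltnS => j5.
have j5R : j%:R <= 5 :> R by rewrite ler_nat.
have : j.+1%:R * d <= 6 * d by rewrite ler_pM2r// ler_nat ltnS.
lra.
Qed.
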